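(* (Weighted form) There exist digraphs $A,B$ on a $6$-element vertex set $V$, neither of which contains a directed 2-cycle (on two distinct vertices), with $A\subset B$ and $A\cap B^T=I$, and a weight function $\omega:V\to\mathbb{R}_{\geq 0}$, such that for every $v\in V$, $$\omega(AB(v)) < \omega(A(v))+\omega(B(v))-\omega(v).$$ Likewise, there exist such $A,B,V,\omega$ (with $|V|=6$, $A$ and $B$ without directed 2-cycles, $A\cap B^T=I$, and the same strict inequality for every $v\in V$) with $B\subset A$ in place of $A\subset B$. (Unweighted form) There exist digraphs $A\subset B$ on a vertex set $V$ with $|V|=36$ such that $A\cap B^T=I$ and, for every $v\in V$, $$|AB(v)| < |A(v)|+|B(v)|-1.$$ Likewise, there exist digraphs $B\subset A$ on a vertex set $V$ with $|V|=64$ such that $A\cap B^T=I$ and $|AB(v)| < |A(v)|+|B(v)|-1$ for every $v\in V$.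
   Context: A directed graph (digraph) on a finite vertex set $V$ is identified with its edge set, a subset of $V\times V$ (self-loops are allowed, parallel edges are not), so set operations apply to digraphs on the same vertex set. Notation for digraphs $A,B\subseteq V\times V$: $I=\{(v,v)\mid v\in V\}$ is the identity graph; $A^T=\{(u,v)\mid (v,u)\in A\}$ is the transpose of $A$; the product graph is $AB=\{(u,v)\mid \exists w\in V,\ (u,w)\in A \text{ and } (w,v)\in B\}$; for $v\in V$, $A(v)=\{u\in V\mid (v,u)\in A\}$, and $AB(v)$ means $(AB)(v)$. For $\omega:V\to\mathbb{R}_{\geq 0}$ and $S\subseteq V$, $\omega(S)=\sum_{u\in S}\omega(u)$. A directed 2-cycle in $A$ is a pair of distinct vertices $u,v$ with $(u,v),(v,u)\in A$. *)

(* Defs.v *)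
From HB Require Import structures.
From mathcomp Require Import all_boot all_order all_algebra.
From mathcomp Require Import reals.

Set Implicit Arguments.
Unset Strict Implicit.
Unset Printing Implicit Defensive.

Import Order.TTheory GRing.Theory Num.Theory.
Local Open Scope ring_scope.

Section Digraph.
Variable V : finType.
Implicit Types (A B : {set V * V}) (v : V).

(* A digraph on [V] is its edge set; self-loops are allowed. *)
Definition dg_id : {set V * V} := [set e | e.1 == e.2].

Definition dg_tr A : {set V * V} := [set e | (e.2, e.1) \in A].

Definition dg_mul A B : {set V * V} :=
  [set e | [exists w, ((e.1, w) \in A) && ((w, e.2) \in B)]].

Definition out_nbr A v : {set V} := [set u | (v, u) \in A].

Definition has_2cycle A : Prop :=
  exists u v, [/\ u <> v, (u, v) \in A & (v, u) \in A].

Definition weight (R : realType) (w : V -> R) (S : {set V}) : R :=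
  \sum_(u in S) w u.

Definition weighted_ineq (R : realType) (w : V -> R) A B : Prop :=
  forall v, weight w (out_nbr (dg_mul A B) v)
            < weight w (out_nbr A v) + weight w (out_nbr B v) - w v.

(* The cardinals are cast to [int] so that the subtraction is not truncated. *)
Definition card_ineq A B : Prop :=
  forall v, #|out_nbr (dg_mul A B) v|%:Z
            < #|out_nbr A v|%:Z + #|out_nbr B v|%:Z - 1.

End Digraph.

(* Main.v *)
Require Import Defs.
From HB Require Import structures.
From mathcomp Require Import all_boot all_order all_algebra.
From mathcomp Require Import reals.
From mathcomp Require Import zify.

Set Implicit Arguments.
Unset Strict Implicit.
Unset Printing Implicit Defensive.

Import Order.TTheory GRing.Theory Num.Theory.
Local Open Scope ring_scope.

(** Write [a] and [b] for [A] and [B] without their loops.  If [A] is contained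
    in [B], then [AB(v)] is the disjoint union of [B(v)] and of the set of those
    vertices outside [B(v)] that are reached by an edge of [a] followed by one of
    [b]; the required inequality says that this second neighbourhood weighs
    strictly less than [a(v)].  Symmetrically, if [B] is contained in [A], the
    part of [AB(v)] outside [A(v)] must weigh less than [b(v)].  For a fixed pair
    of digraphs this is a system of six homogeneous linear inequalities in the
    weights, and the proof exhibits, for each of the two inclusions, a pair in
    which the larger digraph is a tournament with loops, together with a solution
    of the system in positive integers.  Each solution is verified by evaluating
    the inequalities on adjacency lists ([adj_sound], [nat_ineq_adj]).

    The unweighted examples are blow-ups of the weighted ones: every vertex [v]
    becomes an independent set of [w v] copies, each carrying its loop.  Passing
    to the blow-up replaces the weight of a set containing [v] by that weight
    minus [w v] plus 1 ([card_out_blowup]).  This applies to [A(v)], [B(v)] and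
    [AB(v)] alike: since [A] meets the transpose of [B] only in loops, an
    edge of the blow-up of [A] followed by an edge of the blow-up of [B] never
    leads from a copy of [v] to another copy of [v] ([mul_blowup_sub]).  So the weighted inequality for [v] turns into the
    cardinality inequality for the copies of [v] ([card_ineq_blowup]), and the
    blow-up has as many vertices as the total weight: 36 in the first example
    and 64 in the second. *)

(** * Integer weights *)

Section NatWeights.
Variable V : finType.
Implicit Types (A B : {set V * V}) (w : V -> nat) (v : V) (S : {set V}).

Definition nat_weight w S : nat := (\sum_(u in S) w u)%N.

(** The term [w v] stands on the left to avoid truncated subtraction. *)
Definition nat_ineq w A B : Prop := forall v,
  (nat_weight w (out_nbr (dg_mul A B) v) + w v
   < nat_weight w (out_nbr A v) + nat_weight w (out_nbr B v))%N.

Lemma weighted_ineq_nat (R : realType) w A B :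
  nat_ineq w A B -> weighted_ineq (fun v => (w v)%:R : R) A B.
Proof.
move=> h v; rewrite /weight -!natr_sum ltrBrDr -!natrD ltr_nat.
exact: h.
Qed.

Lemma dg_id_subl A B : A :&: dg_tr B = dg_id V -> dg_id V \subset A.
Proof. by move <-; apply: subsetIl. Qed.

Lemma dg_id_subr A B : A :&: dg_tr B = dg_id V -> dg_id V \subset B.
Proof.
move=> AB; apply/subsetP=> -[u v] uv; move: (uv).
by rewrite -AB !inE /= => /andP[_]; move: uv; rewrite inE /= => /eqP ->.
Qed.

Lemma loop A v : dg_id V \subset A -> (v, v) \in A.
Proof. by move/subsetP; apply; rewrite inE /=. Qed.

Lemma sub_mulr A B : dg_id V \subset A -> B \subset dg_mul A B.
Proof.
move=> IA; apply/subsetP=> -[u v] uv; rewrite inE /=.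
by apply/existsP; exists u; rewrite loop.
Qed.

Lemma sub_mull A B : dg_id V \subset B -> A \subset dg_mul A B.
Proof.
move=> IB; apply/subsetP=> -[u v] uv; rewrite inE /=.
by apply/existsP; exists v; rewrite uv loop.
Qed.

(** * Blow-ups *)

Section BlowUp.
Variable w : V -> nat.

Definition copies : finType := {v : V & 'I_(w v)}.
Implicit Types x y z : copies.

Definition blowup A : {set copies * copies} :=
  [set e | (e.1 == e.2)
        || ((tag e.1 != tag e.2) && ((tag e.1, tag e.2) \in A))].

Lemma card_copies_of S : #|[set y : copies | tag y \in S]| = nat_weight w S.
Proof.
rewrite cardsE -sum1_card /nat_weight.
transitivity (\sum_(v in S) \sum_(i : 'I_(w v)) 1)%N.
  by rewrite sig_big_dep; apply: eq_bigl => y; rewrite /= andbT.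
by apply: eq_bigr => v _; rewrite sum1_card card_ord.
Qed.

Lemma card_copies : #|copies| = (\sum_v w v)%N.
Proof.
rewrite -cardsT -[RHS](eq_bigl _ _ (fun v => in_setT v)).
by rewrite -[RHS]card_copies_of; apply: eq_card => y; rewrite !inE.
Qed.

Lemma blowup_sub A B : A \subset B -> blowup A \subset blowup B.
Proof.
move=> /subsetP AB; apply/subsetP=> e; rewrite !inE.
by case/orP=> [->//|/andP[-> /AB ->]]; rewrite orbT.
Qed.

(** An edge of [B] outside [A] is seen in the blow-up only if both of its ends
    have copies, whence the hypothesis on [w]. *)
Lemma blowup_proper A B : (forall v, 0 < w v)%N -> dg_id V \subset A ->
  A \proper B -> blowup A \proper blowup B.
Proof.
move=> w0 IA /properP[AB [[u v] uvB uvA]].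
have uv : u != v by apply: contra uvA => /eqP <-; apply: loop.
apply/properP; split; first exact: blowup_sub.
pose cp t : copies := Tagged (fun v => 'I_(w v)) (Ordinal (w0 t)).
have ncp : cp u != cp v.
  by apply: contra uv => /eqP/(congr1 tag) /= ->.
by exists (cp u, cp v); rewrite !inE /= (negPf ncp) /= uv //= (negPf uvA).
Qed.

Lemma blowup_id A B : A :&: dg_tr B = dg_id V ->
  blowup A :&: dg_tr (blowup B) = dg_id copies.
Proof.
move=> AB; apply/setP=> -[x y]; rewrite !inE /= (eq_sym y x).
case: (eqVneq x y) => //= _; apply/negP=> /andP[/andP[xy xyA] /andP[_ yxB]].
have: (tag x, tag y) \in dg_id V by rewrite -AB !inE /= xyA.
by rewrite inE /= (negPf xy).
Qed.

(** A walk between two distinct copies of the same vertex would project to a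
    non-loop edge of [A] whose reverse lies in [B]. *)
Lemma mul_blowup_sub A B : A :&: dg_tr B = dg_id V ->
  dg_mul (blowup A) (blowup B) \subset blowup (dg_mul A B).
Proof.
move=> AB; have IA := dg_id_subl AB; have IB := dg_id_subr AB.
apply/subsetP=> -[x z]; rewrite inE /= => /existsP[y /andP[xy yz]].
move: xy; rewrite inE /= => /orP[/eqP xy|/andP[xy xyA]].
  by apply: (subsetP (blowup_sub (sub_mulr B IA))); rewrite xy.
move: yz; rewrite inE /= => /orP[/eqP <-|/andP[yz yzB]].
  apply: (subsetP (blowup_sub (sub_mull A IB))).
  by rewrite inE /= xy xyA orbT.
rewrite inE /=; apply/orP; right; apply/andP; split; last first.
  by rewrite inE /=; apply/existsP; exists (tag y); rewrite xyA.
apply: contra xy => /eqP xz.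
have: (tag x, tag y) \in dg_id V by rewrite -AB !inE /= xyA xz.
by rewrite inE.
Qed.

(** The neighbours of [x] are [x] itself and all copies of the other neighbours
    of [tag x]. *)
Lemma card_out_blowup A x : dg_id V \subset A ->
  (#|out_nbr (blowup A) x| + w (tag x)
   = nat_weight w (out_nbr A (tag x)) + 1)%N.
Proof.
move=> IA; set v := tag x.
have -> : out_nbr (blowup A) x
    = x |: [set y : copies | tag y \in out_nbr A v :\ v].
  by apply/setP=> y; rewrite !inE /= ![_ == x]eq_sym ![_ == v]eq_sym eq_sym.
rewrite cardsU1 card_copies_of !inE eqxx /=.
rewrite [in RHS]/nat_weight (big_setD1 v) /=; last by rewrite inE loop.
by rewrite -/(nat_weight w _); lia.
Qed.

Lemma card_ineq_blowup A B : A :&: dg_tr B = dg_id V -> nat_ineq w A B ->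
  card_ineq (blowup A) (blowup B).
Proof.
move=> AB h x; have IA := dg_id_subl AB; have IB := dg_id_subr AB.
have IAB : dg_id V \subset dg_mul A B := subset_trans IB (sub_mulr B IA).
have le : (#|out_nbr (dg_mul (blowup A) (blowup B)) x|
           <= #|out_nbr (blowup (dg_mul A B)) x|)%N.
  apply/subset_leq_card/subsetP=> y; rewrite !(in_set (fun u => _ \in _)).
  exact: (subsetP (mul_blowup_sub AB)).
have hA := card_out_blowup x IA; have hB := card_out_blowup x IB.
have hAB := card_out_blowup x IAB; have := h (tag x).
lia.
Qed.

End BlowUp.
End NatWeights.

(** * Digraphs given by adjacency lists *)

(** Quantifiers and sums over ['I_n] do not evaluate, but their counterparts on
    [iota 0 n] do. *)
Section Adjacency.
Variable n : nat.
Implicit Types (s a b : seq (seq nat)) (c : seq nat) (p : pred nat).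

(** The lists record the non-loop edges only. *)
Definition edge s i j : bool := (i == j) || (j \in nth [::] s i).

Definition adj s : {set 'I_n * 'I_n} := [set e | edge s (val e.1) (val e.2)].

Definition wt c (i : 'I_n) : nat := nth 0%N c i.

Lemma all_ord p : all p (iota 0 n) -> forall i : 'I_n, p i.
Proof. by move/allP=> h i; apply: h; rewrite mem_iota /=. Qed.

Lemma exists_ord p : [exists i : 'I_n, p i] = has p (iota 0 n).
Proof.
apply/existsP/hasP => [[i pi]|[k]]; first by exists (val i); rewrite ?mem_iota /=.
by rewrite mem_iota => /= kn pk; exists (Ordinal kn).
Qed.

Lemma sum_ord p c : (\sum_(i : 'I_n | p i) wt c i)%N
  = sumn [seq nth 0%N c k | k <- iota 0 n & p k].
Proof.
rewrite sumnE big_map big_filter -(big_mkord p (fun k => nth 0%N c k)).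
by rewrite /index_iota subn0.
Qed.

Definition check2 (r : rel nat) : bool :=
  all (fun i => all (r i) (iota 0 n)) (iota 0 n).

Lemma check2P r : check2 r -> forall i j : 'I_n, r i j.
Proof. by move/all_ord => h i; apply: (all_ord (h i)). Qed.

Definition check_ineq c a b : bool :=
  let W (p : pred nat) := sumn [seq nth 0%N c k | k <- iota 0 n & p k] in
  all (fun i =>
    W (fun j => has (fun k => edge a i k && edge b k j) (iota 0 n)) + nth 0 c i
    < W (edge a i) + W (edge b i))%N (iota 0 n).

Lemma nat_ineq_adj c a b : check_ineq c a b -> nat_ineq (wt c) (adj a) (adj b).
Proof.
move=> /all_ord h v; move: (h v); rewrite -!sum_ord.
congr (_ + _ < _ + _)%N; apply: eq_bigl => u; rewrite !inE //=.
rewrite -exists_ord; apply: eq_existsb => k; by rewrite !inE.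
Qed.

Lemma adj_no_2cycle a :
  check2 (fun i j => ~~ [&& i != j, edge a i j & edge a j i]) ->
  ~ has_2cycle (adj a).
Proof.
move/check2P=> h [u [v [/eqP uv]]]; rewrite !inE /= => uva vua.
by have := h u v; rewrite uva vua !andbT negbK => /eqP/val_inj/eqP; apply/negP.
Qed.

Lemma adj_id a b :
  check2 (fun i j => (edge a i j && edge b j i) == (i == j)) ->
  adj a :&: dg_tr (adj b) = dg_id 'I_n.
Proof.
by move/check2P=> h; apply/setP=> -[u v]; rewrite !inE /= (eqP (h u v)).
Qed.

Lemma adj_proper a b (u v : 'I_n) :
  check2 (fun i j => edge a i j ==> edge b i j) ->
  edge b u v -> ~~ edge a u v -> adj a \proper adj b.
Proof.
move/check2P=> h buv auv; apply/properP; split; last first.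
  by exists (u, v); rewrite !inE.
by apply/subsetP=> -[i j]; rewrite !inE /=; apply/implyP; apply: h.
Qed.

End Adjacency.

(** * The two examples *)

(** [A1] is the tournament [B1] without the edges 1 -> 3, 2 -> 1 and 4 -> 1.  The
    total weight is 36, and all six inequalities hold with a margin of exactly 1. *)
Definition A1 := [:: [:: 1; 4; 5]; [:: 5]; [:: 0]; [:: 0; 2]; [:: 2; 3]; [:: 2; 3; 4]]%N.
Definition B1 := [:: [:: 1; 4; 5]; [:: 3; 5]; [:: 0; 1]; [:: 0; 2]; [:: 1; 2; 3]; [:: 2; 3; 4]]%N.
Definition w1 := [:: 11; 3; 3; 9; 3; 7]%N.

(** [B2] is the tournament [A2] without the edges 1 -> 3, 1 -> 5 and 4 -> 1.  The
    solutions of the six strict inequalities form a nonempty open cone, so every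
    large enough total is that of an integer solution; here it is 64. *)
Definition A2 := [:: [:: 4; 5]; [:: 0; 3; 5]; [:: 0; 1]; [:: 0; 2]; [:: 1; 2; 3]; [:: 2; 3; 4]]%N.
Definition B2 := [:: [:: 4; 5]; [:: 0]; [:: 0; 1]; [:: 0; 2]; [:: 2; 3]; [:: 2; 3; 4]]%N.
Definition w2 := [:: 18; 5; 10; 10; 6; 15]%N.

Lemma A1_proper_B1 : adj 6 A1 \proper adj 6 B1.
Proof. exact: (@adj_proper 6 _ _ (Ordinal (isT : 1 < 6)%N) (Ordinal (isT : 3 < 6)%N)). Qed.

Lemma B2_proper_A2 : adj 6 B2 \proper adj 6 A2.
Proof. exact: (@adj_proper 6 _ _ (Ordinal (isT : 1 < 6)%N) (Ordinal (isT : 3 < 6)%N)). Qed.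

Lemma A1_B1_id : adj 6 A1 :&: dg_tr (adj 6 B1) = dg_id 'I_6.
Proof. exact: adj_id. Qed.

Lemma A2_B2_id : adj 6 A2 :&: dg_tr (adj 6 B2) = dg_id 'I_6.
Proof. exact: adj_id. Qed.

Lemma ineq1 : nat_ineq (@wt 6 w1) (adj 6 A1) (adj 6 B1).
Proof. exact: nat_ineq_adj. Qed.

Lemma ineq2 : nat_ineq (@wt 6 w2) (adj 6 A2) (adj 6 B2).
Proof. exact: nat_ineq_adj. Qed.

Lemma w1_gt0 (v : 'I_6) : (0 < wt w1 v)%N.
Proof. exact: (@all_ord 6 (fun k => 0 < nth 0 w1 k)%N). Qed.

Lemma w2_gt0 (v : 'I_6) : (0 < wt w2 v)%N.
Proof. exact: (@all_ord 6 (fun k => 0 < nth 0 w2 k)%N). Qed.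

Theorem mainTheorem2 (R : realType) :
  [/\ exists (V : finType) (A B : {set V * V}) (w : V -> R),
        [/\ #|V| = 6%N, ~ has_2cycle A /\ ~ has_2cycle B,
            A \proper B /\ A :&: dg_tr B = dg_id V,
            forall v, 0 <= w v & weighted_ineq w A B],
      exists (V : finType) (A B : {set V * V}) (w : V -> R),
        [/\ #|V| = 6%N, ~ has_2cycle A /\ ~ has_2cycle B,
            B \proper A /\ A :&: dg_tr B = dg_id V,
            forall v, 0 <= w v & weighted_ineq w A B],
      exists (V : finType) (A B : {set V * V}),
        [/\ #|V| = 36%N, A \proper B,
            A :&: dg_tr B = dg_id V & card_ineq A B]
    & exists (V : finType) (A B : {set V * V}),
        [/\ #|V| = 64%N, B \proper A,
            A :&: dg_tr B = dg_id V & card_ineq A B]].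
Proof.
have [id1 id2] := (A1_B1_id, A2_B2_id).
split.
- exists 'I_6, (adj 6 A1), (adj 6 B1), (fun v => (wt w1 v)%:R).
  split=> [|||v|]; first exact: card_ord.
  + by split; apply: adj_no_2cycle.
  + by split; [apply: A1_proper_B1|].
  + exact: ler0n.
  + exact/weighted_ineq_nat/ineq1.
- exists 'I_6, (adj 6 A2), (adj 6 B2), (fun v => (wt w2 v)%:R).
  split=> [|||v|]; first exact: card_ord.
  + by split; apply: adj_no_2cycle.
  + by split; [apply: B2_proper_A2|].
  + exact: ler0n.
  + exact/weighted_ineq_nat/ineq2.
- exists (copies (@wt 6 w1)), (blowup (wt w1) (adj 6 A1)), (blowup (wt w1) (adj 6 B1)).
  split.
  + by rewrite card_copies (sum_ord _ xpredT).
  + exact: blowup_proper w1_gt0 (dg_id_subl id1) A1_proper_B1.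
  + exact: blowup_id.
  + exact: card_ineq_blowup ineq1.
- exists (copies (@wt 6 w2)), (blowup (wt w2) (adj 6 A2)), (blowup (wt w2) (adj 6 B2)).
  split.
  + by rewrite card_copies (sum_ord _ xpredT).
  + exact: blowup_proper w2_gt0 (dg_id_subr id2) B2_proper_A2.
  + exact: blowup_id.
  + exact: card_ineq_blowup ineq2.
Qed.
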